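(* The relation algebra $5_7$ is representable over $\mathbb{Z}/5\mathbb{Z}$, and $\mathrm{CySp}(5_7)=\{5\}$.
   Context: $5_7$ is the finite symmetric integral relation algebra with three atoms $1'$ (identity), $a$, $b$ (all symmetric, i.e. self-converse) whose mandatory diversity cycles (up to equivalence) among $aaa$, $bbb$, $abb$, $baa$ are exactly $abb$ and $baa$; the others are forbidden. Equivalently its composition is $a;a=1'+b$, $b;b=1'+a$, $a;b=b;a=a+b$. For a positive integer $n$, a representation of $5_7$ over the cyclic group $\mathbb{Z}/n\mathbb{Z}$ is a partition of $\mathbb{Z}/n\mathbb{Z}$ into $\mathrm{Id}=\{0\}$ and two nonempty sets $A,B$ with $A=-A$, $B=-B$, such that $A+A=B\cup\mathrm{Id}$, $B+B=A\cup\mathrm{Id}$, and $A+B=A\cup B$, where $X+Y=\{x+y : x\in X,\ y\in Y\}$ (addition modulo $n$). The algebra is representable over $\mathbb{Z}/n\mathbb{Z}$ if such a partition exists. The cyclic spectrum is $\mathrm{CySp}(5_7)=\{n : n \text{ a positive integer and } 5_7 \text{ is representable over } \mathbb{Z}/n\mathbb{Z}\}$. *)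

(* Defs.v *)
From mathcomp Require Import all_boot all_order all_algebra.

Set Implicit Arguments.
Unset Strict Implicit.
Unset Printing Implicit Defensive.

Import GRing.Theory.
Local Open Scope ring_scope.

Definition sumset (G : finZmodType) (X Y : {set G}) : {set G} :=
  [set x + y | x in X, y in Y].

Definition oppset (G : finZmodType) (X : {set G}) : {set G} :=
  [set - x | x in X].

(** [5_7] is the symmetric integral relation algebra with atoms [1'], [a], [b]
    and composition [a;a = 1'+b], [b;b = 1'+a], [a;b = b;a = a+b].  In a
    representation over an abelian group [G], the atoms [1'], [a], [b] are
    interpreted by the sets [[set 0]], [A], [B], and relational composition and
    converse by the sumset and the opposite of a set. *)
Record represents_5_7 (G : finZmodType) (A B : {set G}) : Prop :=
  Represents_5_7 {
    rep_neqA : A != set0;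
    rep_neqB : B != set0;
    rep_disjA : [disjoint [set 0] & A];
    rep_disjB : [disjoint [set 0] & B];
    rep_disjAB : [disjoint A & B];
    rep_cover : [set 0] :|: A :|: B = [set: G];
    rep_oppA : A = oppset A;
    rep_oppB : B = oppset B;
    rep_AA : sumset A A = B :|: [set 0];
    rep_BB : sumset B B = A :|: [set 0];
    rep_AB : sumset A B = A :|: B }.

Definition representable_5_7 (G : finZmodType) : Prop :=
  exists A B : {set G}, represents_5_7 A B.

(** For [0 < n] the type ['I_n.-1.+1], with its canonical addition modulo
    [n.-1.+1], is Z/nZ; ['Z_n] would be wrong for [n = 1]. *)
Definition CySp_5_7 (n : nat) : Prop :=
  (0 < n)%N /\ representable_5_7 'I_n.-1.+1.

(* Main.v *)
Require Import Defs.
From mathcomp Require Import all_boot all_order all_algebra.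

(** In a representation both [A] and [B] are sum-free and together they exhaust
    the nonzero elements.  Starting from [1] in [A], this forces [2] in [B],
    [4] in [A], [3] in [B], and then [5] in both [B] (as [1 + 4]) and [A] (as
    [2 + 3]), unless one of these is zero: so [n <= 5], as in the computation of
    the Schur number [S(2) = 4].  For [n <= 4], [B] contains only involutions
    equal to [2], so that [B + B] cannot cover [A]. *)

Set Implicit Arguments.
Unset Strict Implicit.
Unset Printing Implicit Defensive.

Import GRing.Theory.
Local Open Scope ring_scope.

(** Solving for the second summand leaves a single quantifier, which over ['I_5] unrolls into a
    five-term disjunction. *)
Lemma in_sumset (G : finZmodType) (X Y : {set G}) (z : G) :
  (z \in sumset X Y) = [exists x, (x \in X) && (z - x \in Y)].
Proof.
apply/imset2P/existsP => [[x y xX yY ->]|[x /andP[xX zxY]]].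
  by exists x; rewrite xX addrC addKr.
by exists x (z - x) => //; rewrite addrC subrK.
Qed.

Lemma sumsetC (G : finZmodType) (X Y : {set G}) : sumset X Y = sumset Y X.
Proof.
by apply/setP => z; apply/imset2P/imset2P => -[x y xX yY ->];
  exists y x => //; rewrite addrC.
Qed.

Lemma in_oppset (G : finZmodType) (X : {set G}) (x : G) :
  (x \in oppset X) = (- x \in X).
Proof.
apply/imsetP/idP => [[y yX ->]|xX]; first by rewrite opprK.
by exists (- x); rewrite ?opprK.
Qed.

(** The table of $5_7$ is invariant under swapping $a$ and $b$. Hence each fact about [A] also
    serves for [B], and [1] may be assumed to lie in [A]. *)
Lemma represents_5_7C (G : finZmodType) (A B : {set G}) :
  represents_5_7 A B -> represents_5_7 B A.
Proof.
case=> nA nB dA dB dAB cov oA oB AA BB AB; split=> //.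
- by rewrite disjoint_sym.
- by rewrite -cov setUAC.
- by rewrite sumsetC AB setUC.
Qed.

Lemma represents_memN0 (G : finZmodType) (A B : {set G}) (x : G) :
  represents_5_7 A B -> x \in A -> x != 0.
Proof.
move=> repAB xA; apply/eqP => x0; move/pred0P: (rep_disjA repAB) => /(_ 0) /=.
by rewrite inE eqxx -x0 xA.
Qed.

Lemma represents_disjoint (G : finZmodType) (A B : {set G}) (x : G) :
  represents_5_7 A B -> x \in A -> x \in B -> False.
Proof.
move=> repAB xA xB.
by move/pred0P: (rep_disjAB repAB) => /(_ x) /=; rewrite xA xB.
Qed.

Lemma represents_cover (G : finZmodType) (A B : {set G}) (x : G) :
  represents_5_7 A B -> x != 0 -> x \in A \/ x \in B.
Proof.
move=> repAB x0; have := in_setT x; rewrite -(rep_cover repAB) !inE (negPf x0) /=.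
by move/orP.
Qed.

Lemma represents_memN (G : finZmodType) (A B : {set G}) (x : G) :
  represents_5_7 A B -> x \in A -> - x \in A.
Proof.
by move=> repAB; rewrite {1}(rep_oppA repAB) in_oppset.
Qed.

Lemma represents_memD (G : finZmodType) (A B : {set G}) (x y : G) :
  represents_5_7 A B -> x \in A -> y \in A -> x + y != 0 -> x + y \in B.
Proof.
move=> repAB xA yA xy0.
have : x + y \in sumset A A by apply/imset2P; exists x y.
by rewrite (rep_AA repAB) !inE (negPf xy0) orbF.
Qed.

Lemma inZpD m i j : (inZp i + inZp j : 'I_m.+1) = inZp (i + j).
Proof. by apply: val_inj; rewrite /= modnDm. Qed.

Lemma inZp_neq0 m k : (0 < k <= m)%N -> (inZp k : 'I_m.+1) != 0.
Proof.
by case/andP=> k0 km; apply/eqP => /(congr1 val) /=; rewrite modn_small // => k_eq0;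
  rewrite k_eq0 in k0.
Qed.

Lemma represents_5_7_leq m (A B : {set 'I_m.+1}) :
  represents_5_7 A B -> inZp 1 \in A -> (m <= 4)%N.
Proof.
move=> repAB A1; have repBA := represents_5_7C repAB.
rewrite leqNgt; apply/negP => m5.
have nz k : (0 < k <= 5)%N -> (inZp k : 'I_m.+1) != 0.
  by case/andP=> k0 k5; apply: inZp_neq0; rewrite k0 (leq_trans k5).
have addA i j : inZp i \in A -> inZp j \in A -> (0 < i + j <= 5)%N ->
    (inZp (i + j) : 'I_m.+1) \in B.
  by move=> Ai Aj ij; rewrite -inZpD; apply: represents_memD repAB Ai Aj _;
    rewrite inZpD nz.
have addB i j : inZp i \in B -> inZp j \in B -> (0 < i + j <= 5)%N ->
    (inZp (i + j) : 'I_m.+1) \in A.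
  by move=> Bi Bj ij; rewrite -inZpD; apply: represents_memD repBA Bi Bj _;
    rewrite inZpD nz.
have B2 := addA 1 1 A1 A1 isT; have A4 := addB 2 2 B2 B2 isT.
have B5 := addA 1 4 A1 A4 isT.
(* If [3] is in [A], then [1 + 3 = 4] falls in [B] as well as [A]; if [3] is in [B], then
   [2 + 3 = 5] falls in [A] as well as [B]. *)
have [A3|B3] := represents_cover repAB (nz 3 isT).
  exact: represents_disjoint repAB A4 (addA 1 3 A1 A3 isT).
exact: represents_disjoint repAB (addB 2 3 B2 B3 isT) B5.
Qed.

Lemma represents_5_7_geq m (A B : {set 'I_m.+1}) :
  represents_5_7 A B -> inZp 1 \in A -> (4 <= m)%N.
Proof.
move=> repAB A1; have repBA := represents_5_7C repAB.
rewrite leqNgt; apply/negP => m3.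
have AN1 := represents_memN repAB A1.
have B_eq2 x : x \in B -> m = 3%N /\ x = inZp 2.
  move=> Bx; have x0 := represents_memN0 repBA Bx.
  have x1 : x != inZp 1.
    by apply/eqP => xE; rewrite xE in Bx; exact: represents_disjoint repAB A1 Bx.
  have xN1 : x != - inZp 1.
    by apply/eqP => xE; rewrite xE in Bx; exact: represents_disjoint repAB AN1 Bx.
  move: x x0 x1 xN1 {Bx}; clear -m3.
  (* Up to order 3 every element is [0], [1] or [-1]; in order 4 only [2] is left. *)
  by case: m m3 => [|[|[|[|//]]]] _ [[|[|[|[|k]]]] ltk] //=; split=> //; apply: val_inj.
have : inZp 1 \in sumset B B by rewrite (rep_BB repAB) inE A1.
case/imset2P => x y /B_eq2[m_eq ->] /B_eq2[_ ->].
(* The only sum available in [B] is [2 + 2], which is [0] modulo 4 and not [1]. *)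
by move: m_eq; clear; case: m => [|[|[|[|m]]]] // _ /(congr1 val).
Qed.

Lemma represents_5_7_order m (A B : {set 'I_m.+1}) :
  represents_5_7 A B -> m = 4%N.
Proof.
wlog A1 : A B / inZp 1 \in A => [wlogA repAB|repAB].
  (* In the trivial group [1] equals [0] and could not be placed in [A] or [B]; but there [A] would
     have no nonzero element to contain. *)
  have m_gt0 : (0 < m)%N.
    case/set0Pn: (rep_neqA repAB) => x /(represents_memN0 repAB).
    rewrite lt0n; apply: contra_neq => m0; move: x; rewrite m0 => x.
    exact: ord1.
  have [A1|B1] := represents_cover repAB (@inZp_neq0 m 1 m_gt0).
    exact: wlogA A1 repAB.
  exact: wlogA B1 (represents_5_7C repAB).
apply/eqP; rewrite eqn_leq.
by rewrite (represents_5_7_leq repAB) // (represents_5_7_geq repAB).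
Qed.

Lemma representable_5_7_I5 : representable_5_7 'I_5.
Proof.
(* The nonzero squares modulo 5 and, next, the nonsquares: the edges of the pentagon and those of
   its complement. *)
exists [set x | (val x == 1%N) || (val x == 4%N)].
exists [set x | (val x == 2%N) || (val x == 3%N)].
have I5P (P : pred 'I_5) :
    [&& P (inZp 0), P (inZp 1), P (inZp 2), P (inZp 3) & P (inZp 4)] ->
    forall x, P x.
  case/and5P => P0 P1 P2 P3 P4 [[|[|[|[|[|//]]]]] ltx].
  - by rewrite (_ : Ordinal ltx = inZp 0) //; apply: val_inj.
  - by rewrite (_ : Ordinal ltx = inZp 1) //; apply: val_inj.
  - by rewrite (_ : Ordinal ltx = inZp 2) //; apply: val_inj.
  - by rewrite (_ : Ordinal ltx = inZp 3) //; apply: val_inj.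
  - by rewrite (_ : Ordinal ltx = inZp 4) //; apply: val_inj.
split.
- by apply/set0Pn; exists (inZp 1); rewrite inE.
- by apply/set0Pn; exists (inZp 2); rewrite inE.
1-3: by apply/pred0P => x /=; rewrite !inE; apply/eqP; move: x; apply: I5P.
all: apply/setP => x; rewrite ?in_oppset ?in_sumset -?big_orE !inE.
(* The existentials, now boolean disjunctions over ['I_5], are expanded term by term, so that [I5P]
   leaves closed computations. *)
all: rewrite 1?big_mkcond ?big_ord_recl ?big_ord0 ?inE.
all: by apply/eqP; move: x; apply: I5P.
Qed.

Theorem theorem9 :
  representable_5_7 'I_5 /\ (forall n : nat, CySp_5_7 n <-> n = 5%N).
Proof.
split=> [|n]; first exact: representable_5_7_I5.
split=> [[n_gt0 [A [B /represents_5_7_order n4]]]|->].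
  by rewrite -(prednK n_gt0) n4.
by split=> //; exact: representable_5_7_I5.
Qed.
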